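(* Let $q$ be a prime power, let $Y \subseteq \mathbb{F}_q\setminus\{0\}$, $C\subseteq\mathbb{F}_q$, and $E = C\times C$. Then there exists $y\in Y$ such that \[ |\{ay+b : (a,b)\in E\}| \gg \min\left\{ q,\ \frac{|Y|\,|E|}{q} \right\}. \]
   Context: $\mathbb{F}_q$ is the finite field with $q$ elements. The notation $f\gg g$ means $f\ge cg$ for an absolute constant $c>0$ not depending on any other parameters. *)

(* Defs.v *)
From mathcomp Require Export all_boot all_order all_algebra all_field.
From mathcomp Require Export reals.

Set Implicit Arguments.
Unset Strict Implicit.
Unset Printing Implicit Defensive.

(* Main.v *)
Require Import Defs.
From mathcomp Require Import all_boot all_order all_algebra all_field.
From mathcomp Require Import reals.
From mathcomp Require Import ring lra zify.

Set Implicit Arguments.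
Unset Strict Implicit.
Unset Printing Implicit Defensive.

Import Order.TTheory GRing.Theory Num.Theory.
Local Open Scope ring_scope.

(** Let [N_y] count the ordered pairs of points of [E], the diagonal included,
    with the same image under the map [ay + b].
    Two distinct points of [E] collide for at most one [y], so the sum of [N_y]
    over all [y] in [F] is at most [q |E| + |E|^2]; by Cauchy-Schwarz each [N_y]
    is at least [|E|^2 / q].  Hence the sum of the excesses [N_y - |E|^2 / q]
    over [Y] is at most [q |E|], some [y] in [Y] has
    [N_y <= |E|^2 / q + q |E| / |Y|], and Cauchy-Schwarz again turns this into
    a lower bound for the image. *)

Definition collisions (T U : finType) (f : T -> U) (A : {set T}) : nat :=
  (\sum_(x in A) \sum_(x' in A) (f x' == f x))%N.

Lemma sum_sqr_le (I : finType) (S : {set I}) (r : I -> nat) :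
  ((\sum_(i in S) r i) ^ 2 <= #|S| * \sum_(i in S) r i ^ 2)%N.
Proof.
(* After doubling, both sides are sums over ordered pairs, compared termwise by
   [2 r_i r_j <= r_i^2 + r_j^2]. *)
rewrite -(leq_pmul2l (isT : (0 < 2)%N)).
have -> : (2 * (#|S| * \sum_(i in S) r i ^ 2) =
    \sum_(i in S) \sum_(j in S) (r i ^ 2 + r j ^ 2))%N.
  symmetry; rewrite mul2n -addnn.
  under eq_bigr => i _ do rewrite big_split sum_nat_const /=.
  by rewrite big_split /= -big_distrr /= sum_nat_const.
rewrite -mulnn big_distrl big_distrr /=; apply: leq_sum => i _.
rewrite !big_distrr /=; apply: leq_sum => j _.
exact: nat_Cauchy.
Qed.

(** The fibre sizes [r u] over the image sum to [#|A|], and their squares sum to the number of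
    collisions. *)
Lemma sqr_card_le_collisions (T U : finType) (f : T -> U) (A : {set T}) :
  (#|A| ^ 2 <= #|f @: A| * collisions f A)%N.
Proof.
pose r u := (\sum_(x in A) (f x == u))%N.
have rE u : r u = (\sum_(x in A | f x == u) 1)%N.
  by rewrite /r [RHS]big_mkcondr; apply: eq_bigr => x _; case: eqP.
have part (g : T -> nat) : (\sum_(x in A) g x =
    \sum_(u in f @: A) \sum_(x in A | f x == u) g x)%N.
  by apply: partition_big => x xA; apply: imset_f.
have -> : #|A| = (\sum_(u in f @: A) r u)%N.
  by rewrite -sum1_card part; apply: eq_bigr => u _; rewrite rE.
have -> : collisions f A = (\sum_(u in f @: A) r u ^ 2)%N.
  rewrite /collisions part; apply: eq_bigr => u _.
  rewrite -mulnn {1}rE big_distrl /=.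
  by apply: eq_bigr => x /andP[_ /eqP ->]; rewrite mul1n.
exact: sum_sqr_le.
Qed.

Lemma card_slopes_le (F : finFieldType) (e e' : F * F) :
  (\sum_(y : F) (e'.1 * y + e'.2 == e.1 * y + e.2)%R <= 1 + #|F| * (e' == e))%N.
Proof.
have [-> | ne] := eqVneq e' e.
  by rewrite muln1 -sum1_card; apply: leq_trans (leq_addl _ _); apply: leq_sum
     => y _; apply: leq_b1.
have -> : (\sum_(y : F) (e'.1 * y + e'.2 == e.1 * y + e.2)%R)%N =
    #|[set y | e'.1 * y + e'.2 == e.1 * y + e.2]|.
  by rewrite -sum1dep_card [RHS]big_mkcond; apply: eq_bigr => y _; case: eqP.
rewrite muln0 addn0; apply/card_le1_eqP => y z; rewrite !inE => /eqP ey /eqP ez.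
(* Subtract the collision equations at [y] and [z]. If the slopes agreed, either equation would
   force equal intercepts, hence [e' = e]. *)
have prod0 : (e'.1 - e.1) * (y - z) = 0.
  have -> : (e'.1 - e.1) * (y - z) =
    (e'.1 * y + e'.2) - (e.1 * y + e.2) - ((e'.1 * z + e'.2) - (e.1 * z + e.2))
    by ring.
  by rewrite ey ez !subrr.
move/eqP: prod0; rewrite mulf_eq0 !subr_eq0 => /orP[/eqP a_eq|/eqP //].
case/negP: ne; rewrite -pair_eqE /= a_eq eqxx /=.
by move: ey; rewrite a_eq => /addrI ->.
Qed.

(** Summing over [y] innermost, each fixed [e] contributes at most 1 for every [e'] in [E], plus
    [#|F|] for [e' = e]. *)
Lemma sum_collisions_le (F : finFieldType) (E : {set F * F}) :
  (\sum_(y : F) collisions (fun e : F * F => (e.1 * y + e.2)%R) E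
     <= #|F| * #|E| + #|E| ^ 2)%N.
Proof.
rewrite exchange_big /= addnC -mulnn -mulnDl mulnC -sum_nat_const.
apply: leq_sum => e eE; rewrite exchange_big /=.
apply: (@leq_trans (\sum_(e' in E) (1 + #|F| * (e' == e)))%N).
  by apply: leq_sum => e' _; apply: card_slopes_le.
rewrite big_split /= sum1_card leq_add2l -big_distrr /=.
by rewrite (bigD1 e) //= eqxx big1 ?addn0 ?muln1 // => e' /andP[_ /negbTE->].
Qed.

Lemma exists_few_collisions (F : finFieldType) (Y : {set F}) (E : {set F * F}) :
  Y != set0 -> exists2 y, y \in Y &
    (#|F| * #|Y| * collisions (fun e : F * F => (e.1 * y + e.2)%R) E
      <= #|F| ^ 2 * #|E| + #|Y| * #|E| ^ 2)%N.
Proof.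
case/set0Pn => y0 y0Y.
pose N y := collisions (fun e : F * F => (e.1 * y + e.2)%R) E.
(* A minimiser of [N] on [Y] is at most the average over [Y]. *)
have [y yY ymin] := arg_minnP N y0Y; exists y => //; rewrite -/(N y).
have sumY : (#|Y| * N y <= \sum_(z in Y) N z)%N.
  by rewrite -sum_nat_const; apply: leq_sum => z; apply: ymin.
have sumYC : (#|~: Y| * #|E| ^ 2 <= #|F| * \sum_(z in ~: Y) N z)%N.
  rewrite -sum_nat_const big_distrr /=; apply: leq_sum => z _.
  apply: leq_trans (sqr_card_le_collisions (fun e : F * F => (e.1 * z + e.2)%R) E) _.
  by rewrite leq_mul2r max_card orbT.
have sumF : (\sum_(z in Y) N z + \sum_(z in ~: Y) N z
    <= #|F| * #|E| + #|E| ^ 2)%N.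
  apply: leq_trans (sum_collisions_le E); rewrite [leqRHS](bigID (mem Y)) /=.
  by rewrite leq_add2l; under eq_bigl => z do rewrite in_setC.
move: (cardsC Y) sumY sumYC sumF; rewrite -!mulnn.
move: (\sum_(z in Y) N z)%N (\sum_(z in ~: Y) N z)%N => SY SYC <- sumY sumYC sumF.
(* With [#|F|] split as [#|Y| + #|~: Y|], multiply [sumF] and [sumY] by it. The term
   [#|~: Y| * #|E| ^ 2] from [sumYC] then cancels, leaving [#|Y| * #|E| ^ 2]. *)
have := leq_mul (leqnn (#|Y| + #|~: Y|)%N) sumF.
have := leq_mul (leqnn (#|Y| + #|~: Y|)%N) sumY.
nia.
Qed.

Lemma exists_large_image (F : finFieldType) (Y : {set F}) (E : {set F * F}) :
  Y != set0 -> exists2 y, y \in Y &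
    (#|F| * #|Y| * #|E| <=
      #|[set (e.1 * y + e.2)%R | e in E]| * (#|F| ^ 2 + #|Y| * #|E|))%N.
Proof.
move=> Yn0; have [y yY few] := exists_few_collisions E Yn0; exists y => //.
have := sqr_card_le_collisions (fun e : F * F => (e.1 * y + e.2)%R) E.
move: (collisions _ _) few #|_ @: _| => N few s CS.
have [->|E_gt0] := posnP #|E|; first by rewrite muln0.
(* Restoring a factor [#|E|] produces the [#|E| ^ 2] that [CS] bounds by [s * N]; [few] then bounds
   [N]. *)
rewrite -(leq_pmul2r E_gt0).
apply: leq_trans (_ : s * (#|F| * #|Y| * N) <= _)%N.
  by rewrite -mulnA mulnn [leqRHS]mulnCA leq_mul2l CS orbT.
by rewrite -[leqRHS]mulnA leq_mul2l mulnDl -[(#|Y| * _ * _)%N]mulnA mulnn few orbT.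
Qed.

Theorem theorem2p5 (R : realType) :
  exists2 c : R, 0 < c &
    forall (q : nat) (F : finFieldType) (hq : #|F| = q)
           (Y C : {set F}) (hY : Y \subset [set~ 0]) (hY0 : Y != set0)
           (E : {set F * F}) (hE : E = setX C C),
      exists2 y : F, y \in Y &
        c * Num.min q%:R (#|Y|%:R * #|E|%:R / q%:R)
          <= #|[set e.1 * y + e.2 | e in E]|%:R.
Proof.
(* With [p = |Y| |E|] and [s] the image size, [q p <= s (q^2 + p)]. The constant 1/2 comes from
   [q^2 + p <= 2 max(q^2, p)]: the case [p <= q^2] gives [s >= p / (2q)], the other [s >= q / 2]. *)
exists 2^-1 => [|q F hq Y C _ hY0 E _]; first by rewrite invr_gt0.
have [y yY large] := exists_large_image E hY0; exists y => //.
have q_gt0 : 0 < q%:R :> R by rewrite ltr0n -hq; apply/card_gt0P; exists 0.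
move: #|_ @: _| large => s; rewrite {}hq -(ler_nat R) !natrM natrD natrX natrM.
move: q_gt0 (ler0n R s) => + s_ge0; rewrite -mulrA.
move: (q%:R : R) (s%:R : R) s_ge0 => {}q {}s s_ge0 q_gt0.
move: (#|Y|%:R * #|E|%:R : R) => p large.
rewrite ler_pdivrMl //; have [le_pq | lt_qp] := leP p (q ^+ 2).
  rewrite ge_min; apply/orP; right.
  rewrite ler_pdivrMr // -(ler_pM2l q_gt0); apply: le_trans large _; nra.
rewrite ge_min; apply/orP; left.
have p_gt0 : 0 < p by apply: lt_trans lt_qp; rewrite exprn_gt0.
rewrite -(ler_pM2r p_gt0); apply: le_trans large _; nra.
Qed.
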